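(* Let $S$ be a connected Riemann surface and let $\nabla^{(0)}$ be the flat connection on the trivial rank-$n$ bundle over $S$ whose flat sections are the solutions of $\vec\psi'=A(x)\vec\psi$, with monodromy representation $\rho^{(0)}:\pi_1(S)\to\mathrm{GL}_n(\mathbb{C})$, $\gamma\mapsto M_\gamma$. Consider the deformation $\nabla^{(\rho)}$ of $\nabla^{(0)}$ corresponding to $\vec\psi'=(A(x)+\rho B(x))\vec\psi$, where $B(x)$ is a (single-valued) meromorphic matrix-valued function whose poles are among the punctures of $S$. Let $W$ be a (multivalued) fundamental matrix of $\vec\psi'=A\vec\psi$ and define $$C(x):=\int_0^x W^{-1}(t)B(t)W(t)\,dt .$$ Then the jump $$\Delta_aC:=M_a\,C\big((x-a)e^{2\pi i}+a\big)\,M_a^{-1}-C(x)$$ defines a 1-cocycle valued in the adjoint representation: the map $\delta(\gamma):=M_\gamma\,C(\gamma\cdot x)\,M_\gamma^{-1}-C(x)$, which satisfies $\delta(\gamma_a)=\Delta_aC$ for a loop $\gamma_a$ around a puncture $a$, is a 1-cocycle on $\pi_1(S)$ with values in $\mathrm{ad}(\rho^{(0)})$, and it represents a class in the first cohomology group $$[\Delta_aC]\in H^1(S,\mathrm{ad}(\rho^{(0)})).$$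
   Context: All poles of $A$ and $B$ are removed from $S$, so $A$ and $B$ (as coefficients of matrix-valued 1-forms $A\,dx$, $B\,dx$) are holomorphic on $S$; when $S=\mathbb{P}^1\setminus\{a_1,\dots,a_k\}$, $x$ is the standard coordinate. For a multivalued function $F$ on $S$ (i.e. a function on the universal cover), $F(\gamma\cdot x)$ denotes the branch obtained from $F(x)$ by analytic continuation along the loop $\gamma$; for the loop $\gamma_a$ around the puncture $a$ this is written $F((x-a)e^{2\pi i}+a)$. A fundamental matrix is an invertible matrix solution $W'=AW$, and monodromy is defined by $W(\gamma\cdot x)=W(x)M_\gamma$, with $M_a:=M_{\gamma_a}$. Products of loops are composed so that $M_{\gamma\eta}=M_\gamma M_\eta$ (that is, $\gamma\eta$ means continuing along $\eta$ first and then along $\gamma$). $C$ is a (multivalued) antiderivative of $W^{-1}BW$. The module $\mathrm{ad}(\rho^{(0)})$ is $\mathfrak{gl}_n(\mathbb{C})$ with $\gamma$ acting by $X\mapsto M_\gamma XM_\gamma^{-1}$; a map $\delta:\pi_1(S)\to\mathfrak{gl}_n(\mathbb{C})$ (in particular, independent of $x$) is a 1-cocycle if $\delta(\gamma)-\delta(\gamma\eta)+M_\gamma\,\delta(\eta)\,M_\gamma^{-1}=0$ for all $\gamma,\eta$. $H^1(S,\mathrm{ad}(\rho^{(0)}))$ is the cohomology of the associated local system, identified with $H^1(\pi_1(S),\mathrm{ad}(\rho^{(0)}))$. *)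

(* Defs.v *)
From HB Require Import structures.
From mathcomp Require Import all_boot all_order all_algebra.
From mathcomp Require Import generic_quotient ring_quotient.
From mathcomp Require Import all_classical all_reals all_analysis.
From mathcomp Require Import complex ring lra.

Set Implicit Arguments.
Unset Strict Implicit.
Unset Printing Implicit Defensive.

Import numFieldNormedType.Exports.
Import Order.TTheory GRing.Theory Num.Theory.

Local Open Scope classical_set_scope.
Local Open Scope ring_scope.

Section within_continuity.

Lemma within_comp (U V W : topologicalType) (A : set U) (B : set V)
    (f : U -> V) (g : V -> W) :
  {within A, continuous f} -> {within B, continuous g} ->
  (forall x, A x -> B (f x)) -> {within A, continuous (g \o f)}.
Proof.
move=> /subspace_continuousP cf /subspace_continuousP cg AB.
apply/subspace_continuousP => x Ax P /(cg _ (AB _ Ax)) /= gP.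
have fP := cf _ Ax _ gP.
change (nbhs x [set y | A y -> (B (f y) -> P (g (f y)))]) in fP.
change (nbhs x [set y | A y -> P (g (f y))]).
by apply: filterS fP => y /= h Ay; exact: (h Ay (AB _ Ay)).
Qed.

Lemma within_paste (U V : topologicalType) (D A B : set U) (f g h : U -> V) :
  closed D -> closed A -> closed B -> D `<=` A `|` B ->
  {within D `&` A, continuous f} -> {within D `&` B, continuous g} ->
  (forall x, D x -> A x -> h x = f x) -> (forall x, D x -> B x -> h x = g x) ->
  {within D, continuous h}.
Proof.
move=> cD cA cB DAB cf cg hf hg.
have -> : D = (D `&` A) `|` (D `&` B) by rewrite -setIUr; symmetry; apply/setIidPl.
apply: withinU_continuous; [exact: closedI|exact: closedI| |].
- apply: subspace_eq_continuous cf => x /set_mem[Dx Ax].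
  by apply/esym/hf.
- apply: subspace_eq_continuous cg => x /set_mem[Dx Bx].
  by apply/esym/hg.
Qed.


Variable R : realType.

Lemma ctsD (X : topologicalType) (f g : X -> R) :
  continuous f -> continuous g -> continuous (fun x => f x + g x).
Proof. by move=> cf cg x; apply: cvgD; [exact: cf|exact: cg]. Qed.

Lemma ctsM (X : topologicalType) (f g : X -> R) :
  continuous f -> continuous g -> continuous (fun x => f x * g x).
Proof. by move=> cf cg x; apply: cvgM; [exact: cf|exact: cg]. Qed.

Lemma ctsN (X : topologicalType) (f : X -> R) :
  continuous f -> continuous (fun x => - f x).
Proof. by move=> cf x; apply: cvgN; exact: cf. Qed.

Lemma cts_min (X : topologicalType) (f g : X -> R) :
  continuous f -> continuous g -> continuous (fun x => Num.min (f x) (g x)).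
Proof. by move=> cf cg x; exact: (@continuous_min R X f g x (cf x) (cg x)). Qed.

Lemma cts_max (X : topologicalType) (f g : X -> R) :
  continuous f -> continuous g -> continuous (fun x => Num.max (f x) (g x)).
Proof. by move=> cf cg x; exact: (@continuous_max R X f g x (cf x) (cg x)). Qed.

Lemma cts_pair (X : topologicalType) (f g : X -> R) :
  continuous f -> continuous g -> continuous (fun x => (f x, g x)).
Proof. by move=> cf cg x; exact: (cvg_pair (cf x) (cg x)). Qed.

Lemma cts_cst (X : topologicalType) (a : R) : continuous (fun _ : X => a).
Proof. by move=> x; exact: cvg_cst. Qed.

Lemma cts_fst : continuous (fun p : R * R => p.1).
Proof. by move=> x; exact: cvg_fst. Qed.

Lemma cts_snd : continuous (fun p : R * R => p.2).
Proof. by move=> x; exact: cvg_snd. Qed.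

Lemma cts_id : continuous (fun x : R => x).
Proof. by move=> x; exact: cvg_id. Qed.

Lemma closed_fst_le (a : R) : closed [set p : R * R | p.1 <= a].
Proof. by apply: preimage_closed (@closed_le R a) => p _; exact: cvg_fst. Qed.

Lemma closed_fst_ge (a : R) : closed [set p : R * R | a <= p.1].
Proof. by apply: preimage_closed (@closed_ge R a) => p _; exact: cvg_fst. Qed.

Lemma closed_snd_le (a : R) : closed [set p : R * R | p.2 <= a].
Proof. by apply: preimage_closed (@closed_le R a) => p _; exact: cvg_snd. Qed.

Lemma closed_snd_ge (a : R) : closed [set p : R * R | a <= p.2].
Proof. by apply: preimage_closed (@closed_ge R a) => p _; exact: cvg_snd. Qed.

End within_continuity.

Arguments within_comp {U V W A B} f g _ _ _.
Arguments within_paste {U V D} A B f g {h} _ _ _ _ _ _ _ _.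

Local Ltac cts := repeat first
  [ exact: cts_fst | exact: cts_snd | exact: cts_id | exact: cts_cst
  | apply: cts_pair | apply: cts_min | apply: cts_max
  | apply: ctsN | apply: ctsD | apply: ctsM ].


Section paths.
Context {R : realType} {T : topologicalType}.
Implicit Types x y z w : T.

Local Notation I := (`[0, 1]%classic : set R).
Local Notation II := (I `*` I : set (R * R)).

(* The values of a path outside [0, 1] are irrelevant: they are not seen by
   path_homotopic, hence not by homotopy classes. *)
Record cpath x y := CPath {
  cpath_fun :> R -> T ;
  cpath_cts : {within I, continuous cpath_fun} ;
  cpath_zero : cpath_fun 0 = x ;
  cpath_one : cpath_fun 1 = y }.
Arguments cpath_cts {x y} _.

HB.instance Definition _ x y := gen_eqMixin (cpath x y).
HB.instance Definition _ x y := gen_choiceMixin (cpath x y).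

(* Homotopy relative to the endpoints. *)
Definition path_homotopic x y (f g : cpath x y) := exists H : R * R -> T,
  [/\ {within II, continuous H},
      forall t, I t -> H (0, t) = f t,
      forall t, I t -> H (1, t) = g t &
      forall s, I s -> H (s, 0) = x /\ H (s, 1) = y].

Let itvI (t : R) : I t <-> 0 <= t <= 1.
Proof. by rewrite /= in_itv. Qed.

Lemma closed_II : closed II.
Proof.
have -> : II = (fst @^-1` I) `&` (snd @^-1` I) by [].
by apply: closedI; apply: preimage_closed (@itv_closed _ _ _ _) => p _;
  [exact: cvg_fst|exact: cvg_snd].
Qed.

Lemma path_homotopic_refl x y (f : cpath x y) : path_homotopic f f.
Proof.
exists (fun p => f p.2); split=> //.
- refine (within_comp (fun p : R * R => p.2) f _ (cpath_cts f) _).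
    by apply: continuous_subspaceT; cts.
  by move=> p [].
- by move=> s _; rewrite cpath_zero cpath_one.
Qed.

Lemma path_homotopic_sym x y (f g : cpath x y) :
  path_homotopic f g -> path_homotopic g f.
Proof.
move=> [H [cH H0 H1 Hb]]; exists (fun p => H (1 - p.1, p.2)); split=> /=.
- refine (within_comp (fun p : R * R => (1 - p.1, p.2)) H _ cH _).
    by apply: continuous_subspaceT; cts.
  move=> [s t] [/= /itvI s01 /itvI t01]; split; apply/itvI => /=; lra.
- by move=> t It; rewrite subr0 H1.
- by move=> t It; rewrite subrr H0.
- by move=> s /itvI s01; apply: Hb; apply/itvI; lra.
Qed.

Lemma path_homotopic_trans x y (f g h : cpath x y) :
  path_homotopic f g -> path_homotopic g h -> path_homotopic f h.
Proof.
move=> [H [cH H0 H1 Hb]] [K [cK K0 K1 Kb]].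
pose L p := if p.1 <= 2^-1 then H (2 * p.1, p.2) else K (2 * p.1 - 1, p.2).
exists L; split.
- refine (within_paste ([set p : R * R | p.1 <= 2^-1])
      ([set p : R * R | 2^-1 <= p.1]) (fun p : R * R => H (2 * p.1, p.2))
      (fun p : R * R => K (2 * p.1 - 1, p.2)) _ _ _ _ _ _ _ _).
  + exact: closed_II.
  + exact: closed_fst_le.
  + exact: closed_fst_ge.
  + by move=> p _; case: (leP p.1 2^-1) => [?|/ltW ?]; [left|right].
  + refine (within_comp (fun p : R * R => (2 * p.1, p.2)) H _ cH _).
      by apply: continuous_subspaceT; cts.
    move=> [s t] [[/= /itvI s01 /itvI t01]] /= s2.
    by split; apply/itvI => /=; lra.
  + refine (within_comp (fun p : R * R => (2 * p.1 - 1, p.2)) K _ cK _).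
      by apply: continuous_subspaceT; cts.
    move=> [s t] [[/= /itvI s01 /itvI t01]] /= s2.
    by split; apply/itvI => /=; lra.
  + by move=> p _ /= p2; rewrite /L p2.
  + move=> [s t] [/= _ It] /= s2; rewrite /L /=; case: ifPn => // s2'.
    have -> : s = 2^-1 by apply/eqP; rewrite eq_le s2 s2'.
    by rewrite divff// subrr K0// H1.
- by move=> t It; rewrite /L /= invr_ge0 ler0n mulr0 H0.
- move=> t It; rewrite /L /= mulr1 ifF; last by apply/negbTE; rewrite -ltNge; lra.
  by rewrite -[RHS]K1//; congr (K (_, _)); lra.
- move=> s /itvI s01; rewrite /L /=; case: ifPn => s2.
    by apply: Hb; apply/itvI; lra.
  by apply: Kb; apply/itvI; rewrite -ltNge in s2; lra.
Qed.

Section path_homotopy_class.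
Variables x y : T.

Let homb (f g : cpath x y) : bool := `[< path_homotopic f g >].

Let homb_refl : reflexive homb.
Proof. by move=> f; apply/asboolP; exact: path_homotopic_refl. Qed.

Let homb_sym : symmetric homb.
Proof.
by move=> f g; apply/asboolP/asboolP; exact: path_homotopic_sym.
Qed.

Let homb_trans : transitive homb.
Proof.
move=> g f h /asboolP fg /asboolP gh; apply/asboolP.
exact: path_homotopic_trans gh.
Qed.

Definition path_homotopic_equiv := EquivRel homb homb_refl homb_sym homb_trans.

Definition hclass := {eq_quot path_homotopic_equiv}%qT.
HB.instance Definition _ := Choice.on hclass.
HB.instance Definition _ := EqQuotient.on hclass.

Lemma hclassP (f g : cpath x y) :
  (\pi_hclass f = \pi_hclass g)%qT <-> path_homotopic f g.
Proof. by split=> [/eqmodP/asboolP//|fg]; apply/eqmodP/asboolP. Qed.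

End path_homotopy_class.

Lemma cst_path_cts x : {within I, continuous (fun _ : R => x)}.
Proof. by apply: continuous_subspaceT => t; exact: cvg_cst. Qed.

Definition cst_path x : cpath x x :=
  @CPath x x _ (@cst_path_cts x) (erefl x) (erefl x).

Section rev_path.
Variables (x y : T) (f : cpath x y).

Definition rev_path_fun (t : R) := f (1 - t).

Lemma rev_path_cts : {within I, continuous rev_path_fun}.
Proof.
refine (within_comp (fun t : R => 1 - t) f _ (cpath_cts f) _).
  by apply: continuous_subspaceT; cts.
by move=> t /itvI ?; apply/itvI; lra.
Qed.

Lemma rev_path_zero : rev_path_fun 0 = y.
Proof. by rewrite /rev_path_fun subr0 cpath_one. Qed.

Lemma rev_path_one : rev_path_fun 1 = x.
Proof. by rewrite /rev_path_fun subrr cpath_zero. Qed.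

Definition rev_path : cpath y x := @CPath y x _ (@rev_path_cts) rev_path_zero rev_path_one.

End rev_path.

Section cat_path.
Variables (x y z : T) (f : cpath x y) (g : cpath y z).

Definition cat_path_fun (t : R) :=
  if t <= 2^-1 then f (2 * t) else g (2 * t - 1).

Lemma cat_path_cts : {within I, continuous cat_path_fun}.
Proof.
refine (within_paste ([set t : R | t <= 2^-1])
    ([set t : R | 2^-1 <= t]) (fun t : R => f (2 * t))
    (fun t : R => g (2 * t - 1)) _ _ _ _ _ _ _ _).
- exact: itv_closed.
- exact: closed_le.
- exact: closed_ge.
- by move=> t _; case: (leP t 2^-1) => [?|/ltW ?]; [left|right].
- refine (within_comp (fun t : R => 2 * t) f _ (cpath_cts f) _).
    by apply: continuous_subspaceT; cts.
  by move=> t [/itvI ? /= ?]; apply/itvI; lra.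
- refine (within_comp (fun t : R => 2 * t - 1) g _ (cpath_cts g) _).
    by apply: continuous_subspaceT; cts.
  by move=> t [/itvI ? /= ?]; apply/itvI; lra.
- by move=> t _ /= t2; rewrite /cat_path_fun t2.
- move=> t _ /= t2; rewrite /cat_path_fun; case: ifPn => // t2'.
  have -> : t = 2^-1 by apply/eqP; rewrite eq_le t2 t2'.
  by rewrite divff// subrr cpath_zero cpath_one.
Qed.

Lemma cat_path_zero : cat_path_fun 0 = x.
Proof. by rewrite /cat_path_fun invr_ge0 ler0n mulr0 cpath_zero. Qed.

Lemma cat_path_one : cat_path_fun 1 = z.
Proof.
rewrite /cat_path_fun mulr1 ifF; last by apply/negbTE; rewrite -ltNge; lra.
by rewrite -[RHS](cpath_one g); congr (g _); lra.
Qed.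

(* f first, then g. *)
Definition cat_path : cpath x z := @CPath x z _ (@cat_path_cts) cat_path_zero cat_path_one.

End cat_path.

Lemma rev_path_homotopic x y (f f' : cpath x y) :
  path_homotopic f f' -> path_homotopic (rev_path f) (rev_path f').
Proof.
move=> [H [cH H0 H1 Hb]]; exists (fun p => H (p.1, 1 - p.2)); split=> /=.
- refine (within_comp (fun p : R * R => (p.1, 1 - p.2)) H _ cH _).
    by apply: continuous_subspaceT; cts.
  by move=> [s t] [/= /itvI s01 /itvI t01]; split; apply/itvI => /=; lra.
- by move=> t /itvI It; rewrite H0//; apply/itvI; lra.
- by move=> t /itvI It; rewrite H1//; apply/itvI; lra.
- by move=> s /Hb[Hs0 Hs1]; rewrite subr0 subrr.
Qed.

Lemma cat_path_homotopic x y z (f f' : cpath x y) (g g' : cpath y z) :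
  path_homotopic f f' -> path_homotopic g g' ->
  path_homotopic (cat_path f g) (cat_path f' g').
Proof.
move=> [H [cH H0 H1 Hb]] [K [cK K0 K1 Kb]].
pose L p := if p.2 <= 2^-1 then H (p.1, 2 * p.2) else K (p.1, 2 * p.2 - 1).
exists L; split.
- refine (within_paste ([set p : R * R | p.2 <= 2^-1])
      ([set p : R * R | 2^-1 <= p.2]) (fun p : R * R => H (p.1, 2 * p.2))
      (fun p : R * R => K (p.1, 2 * p.2 - 1)) _ _ _ _ _ _ _ _).
  + exact: closed_II.
  + exact: closed_snd_le.
  + exact: closed_snd_ge.
  + by move=> p _; case: (leP p.2 2^-1) => [?|/ltW ?]; [left|right].
  + refine (within_comp (fun p : R * R => (p.1, 2 * p.2)) H _ cH _).
      by apply: continuous_subspaceT; cts.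
    move=> [s t] [[/= /itvI s01 /itvI t01]] /= s2.
    by split; apply/itvI => /=; lra.
  + refine (within_comp (fun p : R * R => (p.1, 2 * p.2 - 1)) K _ cK _).
      by apply: continuous_subspaceT; cts.
    move=> [s t] [[/= /itvI s01 /itvI t01]] /= s2.
    by split; apply/itvI => /=; lra.
  + by move=> p _ /= p2; rewrite /L p2.
  + move=> [s t] [/= Is _] /= t2; rewrite /L /=; case: ifPn => // t2'.
    have -> : t = 2^-1 by apply/eqP; rewrite eq_le t2 t2'.
    by rewrite divff// subrr (Kb _ Is).1 (Hb _ Is).2.
- move=> t /itvI It; rewrite /L /= /cat_path_fun.
  case: ifPn => t2; first by rewrite H0//; apply/itvI; lra.
  by rewrite K0//; apply/itvI; rewrite -ltNge in t2; lra.
- move=> t /itvI It; rewrite /L /= /cat_path_fun.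
  case: ifPn => t2; first by rewrite H1//; apply/itvI; lra.
  by rewrite K1//; apply/itvI; rewrite -ltNge in t2; lra.
- move=> s Is; rewrite /L /= invr_ge0 ler0n mulr0 (Hb _ Is).1; split=> //.
  rewrite mulr1 ifF; last by apply/negbTE; rewrite -ltNge; lra.
  by rewrite -(Kb _ Is).2; congr (K (_, _)); lra.
Qed.

Lemma reparam_homotopic x y a b (F : cpath a b) (u v : cpath x y) (p q : R -> R) :
  continuous p -> continuous q ->
  (forall t, I t -> I (p t)) -> (forall t, I t -> I (q t)) ->
  p 0 = q 0 -> p 1 = q 1 ->
  (forall t, I t -> u t = F (p t)) -> (forall t, I t -> v t = F (q t)) ->
  path_homotopic u v.
Proof.
move=> cp cq Ip Iq pq0 pq1 uE vE.
have I0 : I 0 by apply/itvI; lra.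
have I1 : I 1 by apply/itvI; lra.
exists (fun z : R * R => F ((1 - z.1) * p z.2 + z.1 * q z.2)); split.
- refine (within_comp (fun z : R * R => (1 - z.1) * p z.2 + z.1 * q z.2)
    F _ (cpath_cts F) _).
    apply: continuous_subspaceT.
    have cp2 : continuous (fun z : R * R => p z.2).
      by move=> z; apply: continuous_comp; [exact: cts_snd|exact: cp].
    have cq2 : continuous (fun z : R * R => q z.2).
      by move=> z; apply: continuous_comp; [exact: cts_snd|exact: cq].
    by apply: ctsD; apply: ctsM => //; cts.
  move=> [s t] /= [/= /itvI s01 It]; apply/itvI.
  have /itvI p01 := Ip _ It; have /itvI q01 := Iq _ It.
  by apply/andP; split; nra.
- by move=> t It /=; rewrite uE// subr0 mul1r mul0r addr0.
- by move=> t It /=; rewrite vE// subrr mul0r mul1r add0r.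
- move=> s _ /=; rewrite -pq0 -pq1; split.
    by rewrite -[RHS](cpath_zero u) uE//; congr (F _); lra.
  by rewrite -[RHS](cpath_one u) uE//; congr (F _); lra.
Qed.

Section hclass_ops.
Local Open Scope quotient_scope.

Definition hcst x : hclass x x := \pi_(hclass x x) (cst_path x).

Definition hrev x y (c : hclass x y) : hclass y x :=
  \pi_(hclass y x) (rev_path (repr c)).

(* c first, then d. *)
Definition hcat x y z (c : hclass x y) (d : hclass y z) : hclass x z :=
  \pi_(hclass x z) (cat_path (repr c) (repr d)).

Lemma repr_homotopic x y (f : cpath x y) :
  path_homotopic (repr (\pi_(hclass x y) f)) f.
Proof. by apply/hclassP; rewrite reprK. Qed.

Lemma hrev_pi x y (f : cpath x y) :
  hrev (\pi_(hclass x y) f) = \pi_(hclass y x) (rev_path f).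
Proof. by apply/hclassP/rev_path_homotopic/repr_homotopic. Qed.

Lemma hcat_pi x y z (f : cpath x y) (g : cpath y z) :
  hcat (\pi_(hclass x y) f) (\pi_(hclass y z) g) =
  \pi_(hclass x z) (cat_path f g).
Proof. by apply/hclassP/cat_path_homotopic; exact: repr_homotopic. Qed.

Lemma hcatA x y z w (c : hclass x y) (d : hclass y z) (e : hclass z w) :
  hcat c (hcat d e) = hcat (hcat c d) e.
Proof.
rewrite -[c]reprK -[d]reprK -[e]reprK.
move: (repr c) (repr d) (repr e) => f g h.
rewrite (hcat_pi g h) (hcat_pi f g) (hcat_pi f (cat_path g h)).
rewrite (hcat_pi (cat_path f g) h); apply/hclassP.
apply: (reparam_homotopic (F := cat_path f (cat_path g h)) (p := fun t => t)
  (q := fun t => Num.min (2 * t) (Num.min (t + 4^-1) ((t + 1) * 2^-1)))) => //.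
- by cts.
- by cts.
- by move=> t /itvI ?; apply/itvI; rewrite /Num.min; do !case: ifPn; rewrite -?leNgt; lra.
- by rewrite /Num.min; do !case: ifPn; rewrite -?leNgt; lra.
- by rewrite /Num.min; do !case: ifPn; rewrite -?leNgt; lra.
move=> t /itvI It; rewrite /= /cat_path_fun /= /cat_path_fun.
case: (leP t 2^-1) => t2.
  case: (leP (2 * t) 2^-1) => t4.
    have -> : Num.min (2 * t) (Num.min (t + 4^-1) ((t + 1) * 2^-1)) = 2 * t.
      by rewrite /Num.min; do !case: ifPn; rewrite -?leNgt; lra.
    by rewrite t4.
  have -> : Num.min (2 * t) (Num.min (t + 4^-1) ((t + 1) * 2^-1)) = t + 4^-1.
    by rewrite /Num.min; do !case: ifPn; rewrite -?leNgt; lra.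
  rewrite ifF; last by apply/negbTE; rewrite -ltNge; lra.
  rewrite ifT; last by lra.
  by congr (g _); lra.
have -> : Num.min (2 * t) (Num.min (t + 4^-1) ((t + 1) * 2^-1)) = (t + 1) * 2^-1.
  by rewrite /Num.min; do !case: ifPn; rewrite -?leNgt; lra.
rewrite ifF; last by apply/negbTE; rewrite -ltNge; lra.
rewrite ifF; last by apply/negbTE; rewrite -ltNge; lra.
by congr (h _); lra.
Qed.

Lemma hcat1l x y (c : hclass x y) : hcat (hcst x) c = c.
Proof.
rewrite -[c]reprK /hcst hcat_pi; apply/hclassP; move: (repr c) => f.
apply: (reparam_homotopic (F := f) (p := fun t => Num.max 0 (2 * t - 1))
  (q := fun t => t)) => //.
- by cts.
- by cts.
- by move=> t /itvI ?; apply/itvI; rewrite /Num.max; case: ifPn; rewrite -?leNgt; lra.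
- by rewrite /Num.max; case: ifPn; rewrite -?leNgt; lra.
- by rewrite /Num.max; case: ifPn; rewrite -?leNgt; lra.
move=> t /itvI It; rewrite /= /cat_path_fun /=; case: (leP t 2^-1) => t2.
  rewrite -[LHS](cpath_zero f); congr (f _).
  by rewrite /Num.max; case: ifPn; rewrite -?leNgt; lra.
congr (f _).
by rewrite /Num.max; case: ifPn; rewrite -?leNgt; lra.
Qed.

Lemma hcat1r x y (c : hclass x y) : hcat c (hcst y) = c.
Proof.
rewrite -[c]reprK /hcst hcat_pi; apply/hclassP; move: (repr c) => f.
apply: (reparam_homotopic (F := f) (p := fun t => Num.min 1 (2 * t))
  (q := fun t => t)) => //.
- by cts.
- by cts.
- by move=> t /itvI ?; apply/itvI; rewrite /Num.min; case: ifPn; rewrite -?leNgt; lra.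
- by rewrite /Num.min; case: ifPn; rewrite -?leNgt; lra.
- by rewrite /Num.min; case: ifPn; rewrite -?leNgt; lra.
move=> t /itvI It; rewrite /= /cat_path_fun /=; case: (leP t 2^-1) => t2.
  congr (f _); by rewrite /Num.min; case: ifPn; rewrite -?leNgt; lra.
rewrite -[LHS](cpath_one f); congr (f _).
by rewrite /Num.min; case: ifPn; rewrite -?leNgt; lra.
Qed.

Lemma hcatVr x y (c : hclass x y) : hcat c (hrev c) = hcst x.
Proof.
rewrite -[c]reprK /hcst hrev_pi hcat_pi; apply/hclassP; move: (repr c) => f.
apply: (reparam_homotopic (F := f) (p := fun t => Num.min (2 * t) (2 - 2 * t))
  (q := fun t => 0)) => //.
- by cts.
- by cts.
- by move=> t /itvI ?; apply/itvI; rewrite /Num.min; case: ifPn; rewrite -?leNgt; lra.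
- by move=> t _; apply/itvI; lra.
- by rewrite /Num.min; case: ifPn; rewrite -?leNgt; lra.
- by rewrite /Num.min; case: ifPn; rewrite -?leNgt; lra.
- move=> t /itvI It; rewrite /= /cat_path_fun /= /rev_path_fun.
  case: (leP t 2^-1) => t2; congr (f _).
    by rewrite /Num.min; case: ifPn; rewrite -?leNgt; lra.
  by rewrite /Num.min; case: ifPn; rewrite -?leNgt; lra.
- by move=> t _; rewrite cpath_zero.
Qed.

Lemma hcatVl x y (c : hclass x y) : hcat (hrev c) c = hcst y.
Proof.
rewrite -[c]reprK /hcst hrev_pi hcat_pi; apply/hclassP; move: (repr c) => f.
apply: (reparam_homotopic (F := f) (p := fun t => Num.max (1 - 2 * t) (2 * t - 1))
  (q := fun t => 1)) => //.
- by cts.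
- by cts.
- by move=> t /itvI ?; apply/itvI; rewrite /Num.max; case: ifPn; rewrite -?leNgt; lra.
- by move=> t _; apply/itvI; lra.
- by rewrite /Num.max; case: ifPn; rewrite -?leNgt; lra.
- by rewrite /Num.max; case: ifPn; rewrite -?leNgt; lra.
- move=> t /itvI It; rewrite /= /cat_path_fun /= /rev_path_fun.
  case: (leP t 2^-1) => t2; congr (f _).
    by rewrite /Num.max; case: ifPn; rewrite -?leNgt; lra.
  by rewrite /Num.max; case: ifPn; rewrite -?leNgt; lra.
- by move=> t _; rewrite cpath_one.
Qed.

End hclass_ops.

End paths.

Arguments hclass R {T} x y.
Arguments cpath R {T} x y.

Section fundamental_group.
Variables (R : realType) (T : topologicalType) (x0 : T).

Definition pi1 := hclass R x0 x0.
HB.instance Definition _ := Choice.on pi1.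

(* g * h is the class of the loop that runs through h first, then g. *)
Definition pi1_mul (g h : pi1) : pi1 := hcat h g.

Lemma pi1_mulA : associative pi1_mul.
Proof. by move=> g h k; rewrite /pi1_mul hcatA. Qed.

Lemma pi1_mul1g : left_id (hcst x0 : pi1) pi1_mul.
Proof. by move=> g; exact: hcat1r. Qed.

Lemma pi1_mulg1 : right_id (hcst x0 : pi1) pi1_mul.
Proof. by move=> g; exact: hcat1l. Qed.

Lemma pi1_mulVg : left_inverse (hcst x0 : pi1) (@hrev R T x0 x0) pi1_mul.
Proof. by move=> g; exact: hcatVr. Qed.

Lemma pi1_mulgV : right_inverse (hcst x0 : pi1) (@hrev R T x0 x0) pi1_mul.
Proof. by move=> g; exact: hcatVl. Qed.

HB.instance Definition _ := isGroup.Build pi1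
  pi1_mulA pi1_mul1g pi1_mulg1 pi1_mulVg pi1_mulgV.

End fundamental_group.

Section universal_cover.
Variables (R : realType) (T : topologicalType) (x0 : T).

Definition ucover := {x : T & hclass R x0 x}.
HB.instance Definition _ := gen_eqMixin ucover.
HB.instance Definition _ := gen_choiceMixin ucover.

Definition ucover_proj (p : ucover) : T := projT1 p.

(* Moving the end of p along a path that starts there. *)
Definition ucover_move (p : ucover) (x : T) (c : hclass R (ucover_proj p) x) :
  ucover := existT _ x (hcat (projT2 p) c).

(* F (deck g p) is the branch written F(g . x) for p over x: the loop g comes
   first, then the path that leads to p. *)
Definition deck (g : pi1 R x0) (p : ucover) : ucover :=
  existT _ (ucover_proj p) (hcat g (projT2 p)).

(* The sheets {[p . b] | b a path in U}, U open, are a base of the topology. *)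
Definition ucover_open (A : set ucover) := forall p, A p ->
  exists U : set T, [/\ open U, U (ucover_proj p) &
    forall (x : T) (b : cpath R (ucover_proj p) x),
      (forall t : R, `[0, 1]%classic t -> U (b t)) ->
      A (ucover_move (\pi_(hclass R (ucover_proj p) x) b)%qT)].

Lemma ucover_openT : ucover_open [set: ucover].
Proof. by move=> p _; exists setT; split=> //; exact: openT. Qed.

Lemma ucover_openI (A B : set ucover) :
  ucover_open A -> ucover_open B -> ucover_open (A `&` B).
Proof.
move=> oA oB p [/oA[U [oU Up UA]] /oB[V [oV Vp VB]]].
exists (U `&` V); split=> //; first exact: openI.
by move=> x b UVb; split; [apply: UA|apply: VB] => t /UVb[].
Qed.

Lemma ucover_open_bigcup (J : Type) (f : J -> set ucover) :
  (forall j, ucover_open (f j)) -> ucover_open (\bigcup_j f j).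
Proof.
move=> of_ p [j _ fjp]; have [U [oU Up Uf]] := of_ j _ fjp.
by exists U; split=> // x b Ub; exists j => //; exact: Uf.
Qed.

HB.instance Definition _ := isOpenTopological.Build ucover
  ucover_openT ucover_openI ucover_open_bigcup.

End universal_cover.

(* The complex numbers, with the topology and norm of a numFieldType. *)
Definition Cx (R : realType) : numFieldType := R[i].

Definition expi2pi {R : realType} (t : R) : Cx R :=
  (cos (2 * pi * t) +i* sin (2 * pi * t))%C.

Definition holomorphic_on {R : realType} (U : set (Cx R)) (f : Cx R -> Cx R) :=
  forall z, U z -> derivable f z 1.

Section charts.
Variables (R : realType) (T : topologicalType).

Record chart := Chart {
  chart_dom : set T ;
  chart_map :> T -> Cx R ;
  chart_inv : Cx R -> T ;
  chart_dom_open : open chart_dom ;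
  chart_img_open : open (chart_map @` chart_dom) ;
  chart_cts : {within chart_dom, continuous chart_map} ;
  chart_inv_cts : {within chart_map @` chart_dom, continuous chart_inv} ;
  chartK : forall x, chart_dom x -> chart_inv (chart_map x) = x }.

Definition transition (c d : chart) : Cx R -> Cx R := d \o chart_inv c.

Definition chart_compatible (c d : chart) :=
  holomorphic_on (c @` (chart_dom c `&` chart_dom d)) (transition c d) /\
  holomorphic_on (d @` (chart_dom c `&` chart_dom d)) (transition d c).

End charts.

(* Connectedness is a separate hypothesis; second countability then follows
   from Rado's theorem. *)
Record riemannSurface (R : realType) := RiemannSurface {
  rs_space :> topologicalType ;
  rs_hausdorff : hausdorff_space rs_space ;
  atlas : set (chart R rs_space) ;
  atlas_cover : forall x, exists2 c, atlas c & chart_dom c x ;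
  atlas_compatible : forall c d, atlas c -> atlas d -> chart_compatible c d ;
  atlas_maximal : forall c,
    (forall d, atlas d -> chart_compatible c d) -> atlas c }.

Section connections.
Variables (R : realType) (S : riemannSurface R) (n : nat).

(* A holomorphic n x n matrix-valued 1-form on S: it is
   form_coef c (x) dc in the chart c. *)
Record mform := MForm {
  form_coef : chart R S -> S -> 'M[Cx R]_n ;
  form_holomorphic : forall c, atlas c -> forall i j,
    holomorphic_on (c @` chart_dom c)
      (fun z => form_coef c (chart_inv c z) i j) ;
  form_transition : forall c d, atlas c -> atlas d -> forall x,
    chart_dom c x -> chart_dom d x ->
    form_coef c x = 'D_1 (transition c d) (c x) *: form_coef d x }.

(* The connection d - A on the trivial bundle of rank n is given by its matrix
   A; its flat sections are the solutions of d psi = A psi. *)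
Definition connection := mform.

Definition is_deformation (A B : mform) (nabla : Cx R -> connection) :=
  forall r c x, atlas c -> chart_dom c x ->
  form_coef (nabla r) c x = form_coef A c x + r *: form_coef B c x.

(* A puncture of S: an end of S with a coordinate a that identifies it with the
   punctured unit disc. By closedness, the missing centre is not a point
   of S. *)
Definition is_puncture (a : chart R S) := [/\ atlas a,
  a @` chart_dom a = [set z | 0 < `|z| < 1] &
  forall r : Cx R, 0 < r < 1 ->
    closed (chart_dom a `&` [set x | `|a x| <= r])].

Definition meromorphic_at (B : mform) (a : chart R S) :=
  exists (N : nat) (g : Cx R -> 'M[Cx R]_n),
    (forall i j, holomorphic_on [set z | `|z| < 1] (fun z => g z i j)) /\
    forall x, chart_dom a x -> a x ^+ N *: form_coef B a x = g (a x).

Variable x0 : S.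
Local Notation Su := (ucover R x0).
Implicit Types (F W C : Su -> 'M[Cx R]_n) (p : Su).

(* The derivative at p, with respect to the coordinate c, of a multivalued
   function on S, i.e., a function on the universal cover. *)
Definition has_derivative F (c : chart R S) p (L : 'M[Cx R]_n) :=
  (c (ucover_proj q) - c (ucover_proj p))^-1 *: (F q - F p) @[q --> p^'] --> L.

Definition fundamental_matrix (A : connection) W :=
  (forall p, W p \in unitmx) /\
  forall c p, atlas c -> chart_dom c (ucover_proj p) ->
    has_derivative W c p (form_coef A c (ucover_proj p) *m W p).

(* C is a primitive of W^-1 B W; the lower limit of the integral amounts to the
   choice of an additive constant. *)
Definition antiderivative (B : mform) W C :=
  forall c p, atlas c -> chart_dom c (ucover_proj p) ->
    has_derivative C c p
      (invmx (W p) *m form_coef B c (ucover_proj p) *m W p).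

End connections.

Section group_cohomology.
Variables (G : groupType) (K : fieldType) (n : nat).

Record GLrep := GLRep {
  rep_mx :> G -> 'M[K]_n ;
  rep_unit : forall g, rep_mx g \in unitmx ;
  rep_mul : forall g h, rep_mx (g * h)%g = rep_mx g *m rep_mx h }.

Variable M : GLrep.

Definition ad (g : G) (X : 'M[K]_n) : 'M[K]_n := M g *m X *m invmx (M g).

Lemma ad_is_additive g : {morph ad g : X Y / X - Y}.
Proof. by move=> X Y; rewrite /ad mulmxBr mulmxBl. Qed.

Definition cocycle (d : G -> 'M[K]_n) :=
  forall g h, d g - d (g * h)%g + ad g (d h) = 0.

Definition coboundary (d : G -> 'M[K]_n) :=
  exists X, forall g, d g = ad g X - X.

Definition cocycles : {pred G -> 'M[K]_n} := fun d => `[< cocycle d >].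

Lemma cocycles_zmod : zmod_closed cocycles.
Proof.
split=> [|d e /asboolP dP /asboolP eP]; apply/asboolP => g h.
  by rewrite /= subrr add0r /ad mulmx0 mul0mx.
transitivity ((d g - d (g * h)%g + ad g (d h)) - (e g - e (g * h)%g + ad g (e h))).
  change ((d g - e g) - (d (g * h)%g - e (g * h)%g) + ad g (d h - e h) =
    (d g - d (g * h)%g + ad g (d h)) - (e g - e (g * h)%g + ad g (e h))).
  by rewrite ad_is_additive !opprD !opprK (addrACA (d g)) (addrACA (d g - _)).
by rewrite dP eP subrr.
Qed.

HB.instance Definition _ := GRing.isZmodClosed.Build _ cocycles cocycles_zmod.

Record Z1 := MkZ1 { Z1_fun :> G -> 'M[K]_n ; _ : Z1_fun \in cocycles }.
HB.instance Definition _ := [isSub for Z1_fun].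
HB.instance Definition _ := [Choice of Z1 by <:].
HB.instance Definition _ := [SubChoice_isSubZmodule of Z1 by <:].

Definition B1 : {pred Z1} := fun d => `[< coboundary d >].

Lemma B1_zmod : zmod_closed B1.
Proof.
split=> [|d e /asboolP[X dX] /asboolP[Y eY]]; apply/asboolP.
  by exists 0 => g; rewrite /ad mulmx0 mul0mx subrr.
exists (X - Y) => g; rewrite ad_is_additive.
by transitivity (d g - e g) => //; rewrite dX eY !opprD !opprK addrACA.
Qed.

HB.instance Definition _ := GRing.isZmodClosed.Build _ B1 B1_zmod.

Definition H1 := Quotient.quot B1.
HB.instance Definition _ := GRing.Zmodule.on H1.

Definition H1_class (d : Z1) : H1 := (\pi_(H1) d)%qT.

End group_cohomology.

Section monodromy.
Variables (R : realType) (S : riemannSurface R) (n : nat) (x0 : S).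
Local Notation Su := (ucover R x0).
Local Notation G := (pi1 R x0).
Implicit Types (F W C : Su -> 'M[Cx R]_n) (p : Su).

Definition monodromy_rep W (M : GLrep G (Cx R) n) :=
  forall g p, W (deck g p) = W p *m M g.

Definition jump (M : GLrep G (Cx R) n) F (g : G) p : 'M[Cx R]_n :=
  ad M g (F (deck g p)) - F p.

(* k turns once around the puncture a, starting from x: in the coordinate a, it
   is the circle t |-> a(x) exp(2 i pi t). *)
Definition is_turn (a : chart R S) (x : S) (k : cpath R x x) :=
  forall t : R, `[0, 1]%classic t ->
    chart_dom a (k t) /\ a (k t) = expi2pi t * a x.

(* Analytic continuation along k: for p over x, F (turn k) is the branch
   F((x - a) e^(2 i pi) + a). *)
Definition turn p (k : cpath R (ucover_proj p) (ucover_proj p)) : Su :=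
  ucover_move (\pi_(hclass R _ _) k)%qT.

(* The loop at x0 that follows p, then k, and goes back along p. *)
Definition loop_around p (k : cpath R (ucover_proj p) (ucover_proj p)) : G :=
  hcat (hcat (projT2 p) (\pi_(hclass R _ _) k)%qT) (hrev (projT2 p)).

Definition puncture_jump (M : GLrep G (Cx R) n) F p
    (k : cpath R (ucover_proj p) (ucover_proj p)) : 'M[Cx R]_n :=
  ad M (loop_around k) (F (turn k)) - F p.

End monodromy.

(* Main.v *)
Require Import Defs.
From mathcomp Require Import all_boot all_order all_algebra.
From mathcomp Require Import all_classical all_reals all_analysis.
From mathcomp Require Import complex ring lra.

(* A function with zero derivative on the universal cover is constant: every
   point is reached by lifting a path, and in a chart disc such a path is
   homotopic to a segment, along which the mean value theorem applies.
   With V(p) = W(g . p), both V and W solve the same linear system, so W^-1 V has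
   zero derivative and is a constant M_g. Since W(g . p) = W(p) M_g, the function
   M_g C(g . p) M_g^-1 has the same derivative W^-1 B W as C, so the jump
   delta(g) is constant. The cocycle identity then follows by evaluating delta(h)
   at g . p. *)

Set Implicit Arguments.
Unset Strict Implicit.
Unset Printing Implicit Defensive.

Import numFieldNormedType.Exports.
Import Order.TTheory GRing.Theory Num.Theory.

Local Open Scope classical_set_scope.
Local Open Scope ring_scope.

Lemma comp_continuous (U V W : topologicalType) (f : U -> V) (g : V -> W) :
  continuous f -> continuous g -> continuous (g \o f).
Proof. by move=> cf cg u; apply: continuous_comp; [exact: cf|exact: cg]. Qed.

Section path_lifting.
Context {R : realType} {T : topologicalType}.

Local Notation I := (`[0, 1]%classic : set R).

Let itvI (t : R) : I t <-> 0 <= t <= 1.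
Proof. by rewrite /= in_itv. Qed.

(* Clipping the parameter makes paths, hence their lifts, continuous on all of
   the real line. *)
Definition clip (t : R) : R := Num.max 0 (Num.min 1 t).

Lemma clipI t : 0 <= clip t <= 1.
Proof.
by rewrite /clip /Num.max /Num.min; do !case: ifPn; rewrite -?leNgt; lra.
Qed.

Lemma clip_id t : 0 <= t <= 1 -> clip t = t.
Proof.
by rewrite /clip /Num.max /Num.min; do !case: ifPn; rewrite -?leNgt; lra.
Qed.

Lemma clip_continuous : continuous clip.
Proof.
apply: cts_max; first exact: cts_cst.
by apply: cts_min; [exact: cts_cst|exact: cts_id].
Qed.

Lemma cpath_clip_continuous (x y : T) (f : cpath R x y) : continuous (f \o clip).
Proof.
apply/continuous_subspace_setT; apply: (within_comp (B := I) clip f).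
- by apply: continuous_subspaceT; exact: clip_continuous.
- exact: cpath_cts.
- by move=> t _; apply/itvI/clipI.
Qed.

Lemma hclass_eq (x y y' : T) (f : cpath R x y) (g : cpath R x y') :
  (forall t, 0 <= t <= 1 -> f t = g t) ->
  existT (hclass R x) y (\pi_(hclass R x y) f)%qT =
  existT (hclass R x) y' (\pi_(hclass R x y') g)%qT.
Proof.
move=> fg; have yy' : y = y'.
  by rewrite -(cpath_one f) -(cpath_one g) fg// lexx ler01.
subst y'; congr existT; apply/hclassP.
by apply: (@reparam_homotopic _ _ _ _ _ _ f f g id id) => //;
  [exact: cts_id|exact: cts_id|move=> t /itvI /fg].
Qed.

Section initial_path.
Variables (x y : T) (f : cpath R x y).

Lemma arc_path_cts (s t : R) :
  {within I, continuous (fun u => f (clip (clip s + u * (clip t - clip s))))}.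
Proof.
apply: continuous_subspaceT.
refine (@comp_continuous R R T (fun u => clip s + u * (clip t - clip s))
  (f \o clip) _ _).
  apply: ctsD; first exact: cts_cst.
  by apply: ctsM; [exact: cts_id|exact: cts_cst].
exact: cpath_clip_continuous.
Qed.

Lemma arc_path_zero (s t : R) :
  f (clip (clip s + 0 * (clip t - clip s))) = f (clip s).
Proof. by rewrite mul0r addr0 clip_id// clipI. Qed.

Lemma arc_path_one (s t : R) :
  f (clip (clip s + 1 * (clip t - clip s))) = f (clip t).
Proof. by rewrite mul1r addrC subrK clip_id// clipI. Qed.

Definition arc_path s t : cpath R (f (clip s)) (f (clip t)) :=
  CPath (@arc_path_cts s t) (arc_path_zero s t) (arc_path_one s t).

Lemma initial_path_cts (t : R) :
  {within I, continuous (fun u => f (clip (u * clip t)))}.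
Proof.
apply: continuous_subspaceT.
refine (@comp_continuous R R T (fun u => u * clip t) (f \o clip) _ _).
  by apply: ctsM; [exact: cts_id|exact: cts_cst].
exact: cpath_clip_continuous.
Qed.

Lemma initial_path_zero (t : R) : f (clip (0 * clip t)) = x.
Proof. by rewrite mul0r clip_id ?cpath_zero// lexx ler01. Qed.

Lemma initial_path_one (t : R) : f (clip (1 * clip t)) = f (clip t).
Proof. by rewrite mul1r clip_id// clipI. Qed.

Definition initial_path t : cpath R x (f (clip t)) :=
  CPath (@initial_path_cts t) (initial_path_zero t) (initial_path_one t).

Lemma initial_path_cat s t :
  path_homotopic (Defs.cat_path (initial_path s) (arc_path s t))
    (initial_path t).
Proof.
have /andP[s0 s1] := clipI s; have /andP[t0 t1] := clipI t.
apply: (reparam_homotopic (F := f)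
  (p := fun u => clip (clip s * Num.min (2 * u) 1 +
                 (clip t - clip s) * Num.max 0 (2 * u - 1)))
  (q := fun u => clip (u * clip t))).
- apply: comp_continuous clip_continuous.
  apply: ctsD; apply: ctsM; try exact: cts_cst.
    by apply: cts_min; [apply: ctsM; [exact: cts_cst|exact: cts_id]|exact: cts_cst].
  apply: cts_max; [exact: cts_cst|apply: ctsD; last exact: cts_cst].
  by apply: ctsM; [exact: cts_cst|exact: cts_id].
- apply: comp_continuous clip_continuous.
  by apply: ctsM; [exact: cts_id|exact: cts_cst].
- by move=> u _; apply/itvI/clipI.
- by move=> u _; apply/itvI/clipI.
- by congr clip; rewrite /Num.max /Num.min; do !case: ifPn; rewrite -?leNgt; lra.
- by congr clip; rewrite /Num.max /Num.min; do !case: ifPn; rewrite -?leNgt; lra.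
- move=> u /itvI u01; rewrite /= /cat_path_fun /=; case: ifPn => u2.
    congr (f (clip _)).
    by rewrite /Num.max /Num.min; do !case: ifPn; rewrite -?leNgt; move=> *; nra.
  rewrite -ltNge in u2; congr (f (clip _)).
  by rewrite /Num.max /Num.min; do !case: ifPn; rewrite -?leNgt; move=> *; nra.
- by [].
Qed.

End initial_path.

Variable x0 : T.
Local Notation Tu := (ucover R x0).
Implicit Types p q : Tu.

Lemma ucover_move_eq p (y y' : T) (f : cpath R (ucover_proj p) y)
    (g : cpath R (ucover_proj p) y') :
  (forall t, 0 <= t <= 1 -> f t = g t) ->
  ucover_move (\pi_(hclass R (ucover_proj p) y) f)%qT =
  ucover_move (\pi_(hclass R (ucover_proj p) y') g)%qT.
Proof.
move=> /hclass_eq fg.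
exact: (congr1 (fun d : {y & hclass R (ucover_proj p) y} =>
  ucover_move (projT2 d)) fg).
Qed.

Section path_lift.
Variables (p : Tu) (y : T) (f : cpath R (ucover_proj p) y).

Definition path_lift (t : R) : Tu :=
  ucover_move
    (\pi_(hclass R (ucover_proj p) (f (clip t))) (initial_path f t))%qT.

Lemma ucover_proj_lift t : ucover_proj (path_lift t) = f (clip t).
Proof. by []. Qed.

Lemma path_lift0 : path_lift 0 = p.
Proof.
transitivity (ucover_move (hcst (ucover_proj p) : hclass R _ _)); last first.
  by case: (p) => z c; rewrite /ucover_move /= hcat1r.
apply: ucover_move_eq => t t01 /=.
by rewrite !(clip_id (t := 0)) ?mulr0 ?(clip_id (t := 0)) ?cpath_zero ?lexx
  ?ler01.
Qed.

Lemma path_lift1 : path_lift 1 =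
  ucover_move (\pi_(hclass R (ucover_proj p) y) f)%qT.
Proof.
apply: ucover_move_eq => t t01 /=.
by rewrite (clip_id (t := 1)) ?lexx ?ler01// mulr1 clip_id.
Qed.

Lemma path_lift_move s t :
  path_lift t = @ucover_move _ _ _ (path_lift s) _
    (\pi_(hclass R (f (clip s)) (f (clip t))) (arc_path f s t))%qT.
Proof.
rewrite /path_lift /ucover_move /=; congr existT; rewrite -hcatA; congr hcat.
by rewrite hcat_pi; apply/esym/hclassP/initial_path_cat.
Qed.

Lemma path_lift_continuous : continuous path_lift.
Proof.
move=> t A /=; rewrite nbhsE => -[B [oB Bt] BA].
have [U [oU Ut UB]] := oB _ Bt.
have /nbhs_ballP[e e0 eU] : nbhs (clip t) ((f \o clip) @^-1` U).
  apply: cpath_clip_continuous; apply: open_nbhs_nbhs; split=> //=.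
  by rewrite (clip_id (clipI t)).
have : nbhs t (clip @^-1` ball (clip t) e).
  exact/clip_continuous/nbhsx_ballx.
apply: filterS => s; rewrite /ball /= => ts; apply: BA.
rewrite (path_lift_move t); apply: UB => u /itvI u01 /=; apply: eU.
rewrite /ball /= opprD addrA subrr sub0r normrN normrM distrC.
by apply: le_lt_trans ts; rewrite ler_piMl// ger0_norm; lra.
Qed.

End path_lift.
End path_lifting.

Section complex_plane.
Variable R : realType.

Definition cpx (t : R) : Cx R := (t%:C)%C.
Definition re (z : Cx R) : R := complex.Re z.

Lemma cpxM : {morph cpx : s t / s * t}.
Proof. exact: rmorphM. Qed.

Lemma cpxB : {morph cpx : s t / s - t}.
Proof. exact: rmorphB. Qed.

Lemma cpx_norm (t : R) : `|cpx t| = cpx `|t|.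
Proof. by rewrite /cpx normc_def /= expr0n addr0 sqrtr_sqr. Qed.

Lemma Cx_gt0 (e : Cx R) : 0 < e -> 0 < re e /\ e = cpx (re e).
Proof.
rewrite ltcE /= => /andP[/eqP e0 er]; split=> //.
by rewrite /re /cpx; case: e e0 er => a b /= -> _.
Qed.

Lemma cpx_lt (s t : R) : (cpx s < cpx t) = (s < t).
Proof. by rewrite /cpx ltcE /= eqxx. Qed.

Lemma cpx_continuous : continuous cpx.
Proof.
move=> t A /nbhs_ballP[e /Cx_gt0[e0 ee] eA]; apply/nbhs_ballP.
exists (re e) => // s ts; apply: eA; rewrite /ball /= ee.
by rewrite /cpx -rmorphB cpx_norm cpx_lt.
Qed.

Lemma reB (z w : Cx R) : re (z - w) = re z - re w.
Proof. by case: z w => [a b] [c d]. Qed.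

Lemma Cx_eqP (z w : Cx R) : re z = re w ->
  re (('i)%C * z) = re (('i)%C * w) -> z = w.
Proof.
case: z w => [a b] [c d] /= -> /=.
by rewrite !mul0r !mul1r !sub0r => /oppr_inj ->.
Qed.

Definition segment (z w : Cx R) (t : R) : Cx R := z + cpx t * (w - z).

Lemma segment0 z w : segment z w 0 = z.
Proof. by rewrite /segment /cpx mul0r addr0. Qed.

Lemma segment1 z w : segment z w 1 = w.
Proof. by rewrite /segment /cpx mul1r addrC subrK. Qed.

Lemma ball_segment (o r z w : Cx R) (t : R) : 0 <= t <= 1 ->
  ball o r z -> ball o r w -> ball o r (segment z w t).
Proof.
move=> /andP[t0 t1]; rewrite /ball /= => oz ow.
have -> : o - segment z w t = cpx (1 - t) * (o - z) + cpx t * (o - w).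
  have -> : cpx (1 - t) = 1 - cpx t by rewrite /cpx rmorphB.
  by rewrite /segment; ring.
apply: (le_lt_trans (ler_normD _ _)); rewrite !normrM !cpx_norm.
rewrite (ger0_norm t0) (ger0_norm (_ : 0 <= 1 - t)) ?subr_ge0//.
have -> : r = cpx (1 - t) * r + cpx t * r.
  by rewrite -mulrDl /cpx -rmorphD subrK rmorph1 mul1r.
have c0 (s : R) : 0 <= s -> 0 <= cpx s by rewrite /cpx lecE /= eqxx.
have [->|tn0] := eqVneq t 0.
  by rewrite subr0 /cpx !mul0r !mul1r !addr0.
apply: ler_ltD; first by apply: ler_wpM2l; [rewrite c0 ?subr_ge0|exact: ltW].
by rewrite ltr_pM2l// -[0]/(cpx 0) cpx_lt lt_neqAle eq_sym tn0.
Qed.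

End complex_plane.

Section chart_discs.
Variables (R : realType) (T : topologicalType) (c : chart R T) (z r : Cx R).
Hypothesis disc_sub : ball z r `<=` c @` chart_dom c.

Local Notation I := (`[0, 1]%classic : set R).
Local Notation D := (chart_dom c `&` c @^-1` ball z r).

Lemma chart_invK w : (c @` chart_dom c) w -> c (chart_inv c w) = w.
Proof. by move=> [x cx <-]; rewrite chartK. Qed.

Lemma chart_inv_dom w : (c @` chart_dom c) w -> chart_dom c (chart_inv c w).
Proof. by move=> [x cx <-]; rewrite chartK. Qed.

Section segment_path.
Variables x y : T.
Hypotheses (Dx : D x) (Dy : D y).

Definition segment_path_fun (t : R) := chart_inv c (segment (c x) (c y) t).

Lemma segment_path_disc (t : R) : 0 <= t <= 1 ->
  ball z r (segment (c x) (c y) t).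
Proof. by case: Dx Dy => [_ xz] [_ yz] t01; exact: ball_segment. Qed.

Lemma segment_path_cts : {within I, continuous segment_path_fun}.
Proof.
apply: (within_comp (B := c @` chart_dom c) (segment (c x) (c y))
  (chart_inv c)).
- apply: continuous_subspaceT => t; apply: cvgD; first exact: cvg_cst.
  by apply: cvgM; [exact: cpx_continuous|exact: cvg_cst].
- exact: chart_inv_cts.
- by move=> t; rewrite /= in_itv => t01; exact/disc_sub/segment_path_disc.
Qed.

Lemma segment_path_zero : segment_path_fun 0 = x.
Proof. by rewrite /segment_path_fun segment0 chartK//; case: Dx. Qed.

Lemma segment_path_one : segment_path_fun 1 = y.
Proof. by rewrite /segment_path_fun segment1 chartK//; case: Dy. Qed.

Definition segment_path : cpath R x y :=
  CPath (@segment_path_cts) segment_path_zero segment_path_one.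

Lemma chart_segment_path (t : R) : 0 <= t <= 1 ->
  c (segment_path t) = segment (c x) (c y) t.
Proof. by move=> t01; apply/chart_invK/disc_sub/segment_path_disc. Qed.

Lemma segment_path_dom (t : R) : 0 <= t <= 1 -> D (segment_path t).
Proof.
move=> t01; split; first exact/chart_inv_dom/disc_sub/segment_path_disc.
by rewrite /= chart_segment_path//; exact: segment_path_disc.
Qed.

End segment_path.

Lemma disc_path_homotopic (x y : T) (f g : cpath R x y) :
  (forall t, 0 <= t <= 1 -> D (f t)) -> (forall t, 0 <= t <= 1 -> D (g t)) ->
  path_homotopic f g.
Proof.
move=> Df Dg; have It (t : R) : I t -> 0 <= t <= 1 by rewrite /= in_itv.
exists (fun p => chart_inv c (segment (c (f p.2)) (c (g p.2)) p.1)); split.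
- apply: (within_comp (B := c @` chart_dom c)
    (fun p : R * R => segment (c (f p.2)) (c (g p.2)) p.1) (chart_inv c)).
  + have cts_c (h : cpath R x y) : (forall t, 0 <= t <= 1 -> D (h t)) ->
      {within I `*` I, continuous (fun p : R * R => c (h p.2))}.
      move=> Dh; apply: (within_comp (B := I) (fun p : R * R => p.2) (c \o h)).
      * by apply: continuous_subspaceT; exact: cts_snd.
      * apply: (within_comp (B := chart_dom c) h c).
        - exact: cpath_cts.
        - exact: chart_cts.
        - by move=> t /It/Dh[].
      * by move=> p [].
    move=> p; apply: cvgD; first exact: cts_c.
    apply: cvgM; last by apply: cvgB; exact: cts_c.
    apply: (@continuous_subspaceT _ _ _ (fun p : R * R => cpx p.1)) => q.
    by apply: (continuous_comp (@cts_fst R q)); exact: cpx_continuous.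
  + exact: chart_inv_cts.
  + move=> [s t] [/= /It s01 /It t01]; apply/disc_sub/ball_segment => //.
      by have [] := Df _ t01.
    by have [] := Dg _ t01.
- by move=> t /It/Df[? _] /=; rewrite segment0 chartK.
- by move=> t /It/Dg[? _] /=; rewrite segment1 chartK.
- have Dx : D x by rewrite -(cpath_zero f); apply: Df; rewrite lexx ler01.
  have Dy : D y by rewrite -(cpath_one f); apply: Df; rewrite lexx ler01.
  move=> s _ /=; rewrite !cpath_zero !cpath_one /segment !subrr mulr0 !addr0.
  by case: Dx Dy => [? _] [? _]; rewrite !chartK.
Qed.

End chart_discs.

Section ucover_topology.
Variables (R : realType) (T : topologicalType) (x0 : T).
Local Notation Tu := (ucover R x0).

Lemma ucover_openP (A : set Tu) : open A <-> ucover_open A.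
Proof. by []. Qed.

Lemma ucover_proj_continuous : continuous (fun p : Tu => ucover_proj p).
Proof.
apply/continuousP => A oA; apply/ucover_openP => p Ap; exists A.
split=> // x b Ab; change (A x); rewrite -(cpath_one b); apply: Ab.
by rewrite /= in_itv /= lexx ler01.
Qed.

Lemma deck_continuous (g : pi1 R x0) : continuous (fun p : Tu => deck g p).
Proof.
apply/continuousP => A /ucover_openP oA; apply/ucover_openP => p /oA[U [oU Up UA]].
exists U; split=> // x b Ub.
have := UA x b Ub; rewrite /ucover_move /deck /=.
by rewrite hcatA.
Qed.

Lemma deckM (g h : pi1 R x0) (p : Tu) : deck (g * h)%g p = deck h (deck g p).
Proof. by rewrite /deck /= hcatA. Qed.

End ucover_topology.

Lemma clip_lipschitz (R : realType) (s t : R) : `|clip s - clip t| <= `|s - t|.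
Proof.
have := ler_norm (s - t); have := ler_norm (t - s); rewrite distrC => ts st.
rewrite ler_norml /clip /Num.max /Num.min.
by do !case: ifPn; rewrite -?leNgt => *; lra.
Qed.

Lemma is_derive_littleo (R : realType) (h : R -> R) (t : R) :
  (forall e, 0 < e -> \forall s \near t, `|h s - h t| <= e * `|s - t|) ->
  is_derive t 1 h 0.
Proof.
move=> small.
have d0 : (fun k => k^-1 *: ((h \o shift t) (k *: 1) - h t)) @ 0^' --> (0 : R).
  apply/cvgr0Pnorm_le => e e0.
  have /nbhs_ballP[d d0 dh] := small _ e0.
  apply/nbhs_ballP; exists d => // k; rewrite /ball /= sub0r normrN => kd k0.
  rewrite normrM normfV ler_pdivrMl ?normr_gt0// mulrC.
  have -> : `|k| = `|k%:A + t - t| by rewrite addrK [_%:A]mulr1.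
  by apply: dh; rewrite /ball /= opprD addrCA subrr addr0 normrN [_%:A]mulr1.
by apply: DeriveDef; [apply/cvg_ex; exists 0|exact: cvg_lim].
Qed.

Lemma continuous_at_nbhs (T U : topologicalType) (h : T -> U) (x : T)
    (A : set U) :
  {for x, continuous h} -> nbhs (h x) A -> nbhs x (h @^-1` A).
Proof. by move=> cf /cf. Qed.

Section derivatives.
Variables (R : realType) (S : riemannSurface R) (x0 : S).
Local Notation Su := (ucover R x0).

(* Excluding every q with c(q) = c(p), and not only p, makes it unnecessary to
   know that the cover is locally injective. *)
Definition chart_dnbhs (c : chart R S) (p : Su) : set_system Su :=
  within (fun q => c (ucover_proj q) != c (ucover_proj p)) (nbhs p).

Global Instance chart_dnbhs_filter c p : Filter (chart_dnbhs c p).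
Proof. exact: within_filter. Qed.

Definition zero_derivative (f : Su -> Cx R) (c : chart R S) (p : Su) :=
  (c (ucover_proj q) - c (ucover_proj p))^-1 * (f q - f p)
    @[q --> chart_dnbhs c p] --> (0 : Cx R).

Lemma zero_derivative_near f c p : zero_derivative f c p ->
  forall e, 0 < e -> \forall q \near p,
    c (ucover_proj q) != c (ucover_proj p) ->
    `|f q - f p| <= e * `|c (ucover_proj q) - c (ucover_proj p)|.
Proof.
move=> /cvgr0Pnorm_le f0 e /f0 {}f0.
change (nbhs p [set q | c (ucover_proj q) != c (ucover_proj p) ->
  `|(c (ucover_proj q) - c (ucover_proj p))^-1 * (f q - f p)| <= e]) in f0.
apply: filterS f0 => q /= qe cqp; have := qe cqp.
by rewrite normrM normfV ler_pdivrMl ?normr_gt0 ?subr_eq0// mulrC.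
Qed.

Variable f : Su -> Cx R.
Hypothesis f0 : forall c p, atlas c -> chart_dom c (ucover_proj p) ->
  zero_derivative f c p.

Lemma disc_constant (c : chart R S) (z r : Cx R) (p : Su) (y : S)
    (b : cpath R (ucover_proj p) y) : atlas c ->
  ball z r `<=` c @` chart_dom c ->
  (forall t : R, 0 <= t <= 1 -> (chart_dom c `&` c @^-1` ball z r) (b t)) ->
  f (ucover_move (\pi_(hclass R (ucover_proj p) y) b)%qT) = f p.
Proof.
move=> ac disc Db.
have Dp : (chart_dom c `&` c @^-1` ball z r) (ucover_proj p).
  by rewrite -(cpath_zero b); apply: Db; rewrite lexx ler01.
have Dy : (chart_dom c `&` c @^-1` ball z r) y.
  by rewrite -(cpath_one b); apply: Db; rewrite lexx ler01.
pose l := segment_path disc Dp Dy.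
have -> : (\pi_(hclass R (ucover_proj p) y) b)%qT = (\pi_(hclass R _ y) l)%qT.
  by apply/hclassP; apply: (disc_path_homotopic disc) => //;
    exact: segment_path_dom.
rewrite -path_lift1 -[in RHS](path_lift0 l).
pose w := c y - c (ucover_proj p).
have cl t : c (ucover_proj (path_lift l t)) =
    c (ucover_proj p) + cpx (clip t) * w.
  by rewrite ucover_proj_lift chart_segment_path// clipI.
have lift_eq s t :
    c (ucover_proj (path_lift l s)) = c (ucover_proj (path_lift l t)) ->
    path_lift l s = path_lift l t.
  rewrite !cl => /addrI e; apply: ucover_move_eq => u u01.
  have cu v : 0 <= u * clip v <= 1 by have := clipI v; nra.
  rewrite /= (clip_id (cu s)) (clip_id (cu t)) /segment_path_fun /segment -/w.
  by rewrite !cpxM -!mulrA e.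
(* As clip is 1-Lipschitz, this holds at every real t: the lift has zero
   derivative on the whole line, endpoints included. *)
have small t e : 0 < e ->
    \forall s \near t,
      `|f (path_lift l s) - f (path_lift l t)| <= cpx (e * `|s - t|).
  move=> e0.
  have w0 : 0 < `|w| + 1 by rewrite ltr_wpDl.
  have [m0 mE] := Cx_gt0 w0; set m := re _ in m0 mE.
  have em0 : 0 < cpx (e / m) by rewrite -[0]/(cpx 0) cpx_lt divr_gt0.
  have Dt : chart_dom c (ucover_proj (path_lift l t)).
    rewrite ucover_proj_lift.
    by have [] := segment_path_dom disc Dp Dy (clipI t).
  have near_t := @path_lift_continuous _ _ _ _ _ l t _
    (zero_derivative_near (f0 ac Dt) em0).
  apply: (@filterS _ (nbhs t) _ _ _ _ near_t) => s /= st.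
  have [/lift_eq ->|/st] := eqVneq (c (ucover_proj (path_lift l s)))
                              (c (ucover_proj (path_lift l t))).
    rewrite subrr normr0 -[0]/(cpx 0) /cpx lecR.
    by rewrite mulr_ge0 ?normr_ge0 ?ltW.
  move/le_trans; apply; rewrite !cl opprD addrACA subrr add0r -mulrBl.
  rewrite normrM -cpxB cpx_norm.
  have le1 : cpx `|clip s - clip t| <= cpx `|s - t|.
    by rewrite /cpx lecR clip_lipschitz.
  have -> : cpx (e * `|s - t|) = cpx (e / m) * (cpx `|s - t| * (`|w| + 1)).
    rewrite mE -!cpxM; congr cpx.
    by field; rewrite gt_eqF.
  rewrite ler_pM2l//; apply: ler_pM => //; last by rewrite lerDl.
  by rewrite -cpx_norm.
have const (k : Cx R) : re (k * f (path_lift l 1)) = re (k * f (path_lift l 0)).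
  apply: (is_derive_0_is_cst (f := fun t => re (k * f (path_lift l t)))) => t.
  apply: is_derive_littleo => e e0.
  have k0 : 0 < `|k| + 1 by rewrite ltr_wpDl.
  have [m0 mE] := Cx_gt0 k0; set m := re _ in m0 mE.
  apply: filterS (small t _ (divr_gt0 e0 m0)) => s st.
  rewrite -reB -mulrBr -lecR.
  apply: le_trans (normc_ge_Re _) _; rewrite normrM.
  apply: (@le_trans _ _ ((`|k| + 1) * cpx (e / m * `|s - t|))).
    by apply: ler_pM => //; rewrite lerDl.
  by rewrite mE /cpx -rmorphM lecR mulrA mulrCA mulfV ?gt_eqF// mulr1.
apply: Cx_eqP; last exact: const.
by have := const 1; rewrite !mul1r.
Qed.

Lemma locally_constant (p : Su) : exists U : set S,
  [/\ open U, U (ucover_proj p) &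
    forall (y : S) (b : cpath R (ucover_proj p) y),
    (forall t : R, `[0, 1]%classic t -> U (b t)) ->
    f (ucover_move (\pi_(hclass R (ucover_proj p) y) b)%qT) = f p].
Proof.
have [c ac cp] := atlas_cover (ucover_proj p).
have /nbhs_ballP[r r0 disc] : nbhs (c (ucover_proj p)) (c @` chart_dom c).
  apply: open_nbhs_nbhs.
  by split; [exact: chart_img_open|exists (ucover_proj p)].
have : nbhs (ucover_proj p)
    (chart_dom c `&` c @^-1` ball (c (ucover_proj p)) r).
  apply: filterI.
    by apply: open_nbhs_nbhs; split=> //; exact: chart_dom_open.
  have := @chart_cts _ _ c; rewrite continuous_open_subspace;
    last exact: chart_dom_open.
  move=> cc; have br : nbhs (c (ucover_proj p)) (ball (c (ucover_proj p)) r).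
    exact: nbhsx_ballx.
  exact: continuous_at_nbhs (cc _ (mem_set cp)) br.
rewrite nbhsE => -[U [oU Up] UD]; exists U; split=> // y b Ub.
by apply: (disc_constant ac disc) => t t01; apply/UD/Ub; rewrite /= in_itv.
Qed.

Lemma zero_derivative_constant (p q : Su) : f p = f q.
Proof.
pose o : Su := existT _ x0 (hcst x0).
suff fo r : f r = f o by rewrite fo (fo q).
pose b : cpath R (ucover_proj o) (projT1 r) := repr (projT2 r).
have -> : r = path_lift b 1.
  rewrite path_lift1 /b reprK.
  by case: (r) => y c; rewrite /ucover_move /= hcat1l.
transitivity (f (path_lift b 0)); last by rewrite path_lift0.
have openf (P : set (Cx R)) : open (f @^-1` P).
  apply/ucover_openP => s Ps; have [U [oU Us fU]] := locally_constant s.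
  by exists U; split=> // y a /fU; rewrite /preimage /= => ->.
have oV (P : set (Cx R)) : open [set t : R | P (f (path_lift b t))].
  apply: (open_comp (f := path_lift b)) (openf P) => t _.
  exact: path_lift_continuous.
have cR : connected [set: R] by apply/connected_intervalP.
pose v := f (path_lift b 0).
have /seteqP[_ /(_ 1 I)//] : [set t : R | f (path_lift b t) = v] = setT.
apply: cR; first by exists 0.
- exists [set t : R | f (path_lift b t) = v]; last by rewrite setTI.
  exact: (oV [set v]).
- exists [set t : R | f (path_lift b t) = v]; last by rewrite setTI.
  by rewrite -openC; exact: (oV (~` [set v])).
Qed.

End derivatives.

Section matrix_convergence.
Variables (K : numFieldType) (X : Type) (F : set_system X).
Context {FF : Filter F}.

Lemma cvg_mxP m n (f : X -> 'M[K]_(m, n)) (L : 'M[K]_(m, n)) :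
  f @ F --> L <-> forall i j, f x i j @[x --> F] --> L i j.
Proof.
split=> [fL i j|fL A [P LP PA]].
  apply: (cvg_comp _ (fun N : 'M[K]_(m, n) => N i j) fL).
  exact: coord_continuous.
have : \forall x \near F, forall i j, P i j (f x i j).
  by apply: filter_forall => i; apply: filter_forall => j; exact: fL.
by apply: filterS => x Px; exact: PA.
Qed.

Lemma cvg_sumr (I : Type) (r : seq I) (f : I -> X -> K) (l : I -> K) :
  (forall i, f i x @[x --> F] --> l i) ->
  \sum_(i <- r) f i x @[x --> F] --> \sum_(i <- r) l i.
Proof. by move=> fl; apply: cvg_big => // -[x y]; exact: add_continuous. Qed.

Lemma cvg_prodr (I : Type) (r : seq I) (f : I -> X -> K) (l : I -> K) :
  (forall i, f i x @[x --> F] --> l i) ->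
  \prod_(i <- r) f i x @[x --> F] --> \prod_(i <- r) l i.
Proof. by move=> fl; apply: cvg_big => // -[x y]; exact: mul_continuous. Qed.

Lemma cvg_mulmx m n p (f : X -> 'M[K]_(m, n)) (g : X -> 'M[K]_(n, p))
    (L : 'M[K]_(m, n)) (L' : 'M[K]_(n, p)) :
  f @ F --> L -> g @ F --> L' -> (f x *m g x) @[x --> F] --> L *m L'.
Proof.
move=> /cvg_mxP fL /cvg_mxP gL; apply/cvg_mxP => i j.
under eq_cvg do rewrite mxE.
by rewrite mxE; apply: cvg_sumr => k; exact: cvgM.
Qed.

Lemma cvg_mxD m n (f g : X -> 'M[K]_(m, n)) (L L' : 'M[K]_(m, n)) :
  f @ F --> L -> g @ F --> L' -> (f x + g x) @[x --> F] --> L + L'.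
Proof.
move=> /cvg_mxP fL /cvg_mxP gL; apply/cvg_mxP => i j.
under eq_cvg do rewrite mxE.
by rewrite mxE; exact: cvgD.
Qed.

Lemma cvg_mxN m n (f : X -> 'M[K]_(m, n)) (L : 'M[K]_(m, n)) :
  f @ F --> L -> (- f x) @[x --> F] --> - L.
Proof.
move=> /cvg_mxP fL; apply/cvg_mxP => i j.
under eq_cvg do rewrite mxE.
by rewrite mxE; exact: cvgN.
Qed.

Lemma cvg_mxZ m n (a : X -> K) (f : X -> 'M[K]_(m, n)) (l : K)
    (L : 'M[K]_(m, n)) :
  a @ F --> l -> f @ F --> L -> (a x *: f x) @[x --> F] --> l *: L.
Proof.
move=> al /cvg_mxP fL; apply/cvg_mxP => i j.
under eq_cvg do rewrite mxE.
by rewrite mxE; exact: cvgM.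
Qed.

Lemma cvg_det n (f : X -> 'M[K]_n) (L : 'M[K]_n) :
  f @ F --> L -> \det (f x) @[x --> F] --> \det L.
Proof.
move=> /cvg_mxP fL; apply: cvg_sumr => s.
by apply: cvgM; [exact: cvg_cst|exact: cvg_prodr].
Qed.

Lemma cvg_invmx n (f : X -> 'M[K]_n) (L : 'M[K]_n) :
  (forall x, f x \in unitmx) -> L \in unitmx ->
  f @ F --> L -> invmx (f x) @[x --> F] --> invmx L.
Proof.
move=> fu Lu fL; rewrite /invmx Lu; under eq_cvg do rewrite /invmx fu.
apply: cvg_mxZ.
  by apply: cvgV; [rewrite -unitfE -unitmxE|exact: cvg_det].
apply/cvg_mxP => i j; under eq_cvg do rewrite mxE; rewrite mxE.
apply: cvgM; first exact: cvg_cst.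
apply: cvg_det; apply/cvg_mxP => k l; under eq_cvg do rewrite !mxE.
by rewrite !mxE; move/cvg_mxP: fL; exact.
Qed.

End matrix_convergence.

Lemma invmx_mul (K : fieldType) n (X Y : 'M[K]_n) :
  X \in unitmx -> Y \in unitmx -> invmx (X *m Y) = invmx Y *m invmx X.
Proof.
move=> Xu Yu; have XYu : X *m Y \in unitmx by rewrite unitmx_mul Xu.
rewrite -[LHS](mulmxK Xu) -[X in X *m _](mulmxK Yu).
by rewrite -!mulmxA (mulmxA X) mulKmx.
Qed.

Section matrix_derivatives.
Variables (R : realType) (S : riemannSurface R) (x0 : S) (n : nat).
Local Notation Su := (ucover R x0).
Implicit Types (F H : Su -> 'M[Cx R]_n) (c : chart R S) (p q : Su).

Definition diffq F c p q : 'M[Cx R]_n :=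
  (c (ucover_proj q) - c (ucover_proj p))^-1 *: (F q - F p).

Definition mx_derivative F c p (L : 'M[Cx R]_n) :=
  diffq F c p @ chart_dnbhs c p --> L.

Lemma mx_derivative_eq F c p L L' :
  mx_derivative F c p L -> L = L' -> mx_derivative F c p L'.
Proof. by move=> FL <-. Qed.

Lemma has_derivative_mx F c p L :
  has_derivative F c p L -> mx_derivative F c p L.
Proof.
move=> FL A /FL LA.
change (nbhs p [set q | q != p -> A (diffq F c p q)]) in LA.
change (nbhs p [set q | c (ucover_proj q) != c (ucover_proj p) ->
  A (diffq F c p q)]).
by apply: filterS LA => q Aq cqp; apply: Aq; apply: contra_neq cqp => ->.
Qed.

Lemma mx_derivative_deck F c p L (g : pi1 R x0) :
  mx_derivative F c (deck g p) L -> mx_derivative (F \o deck g) c p L.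
Proof.
move=> FL A /FL LA.
change (nbhs (deck g p) [set q | c (ucover_proj q) != c (ucover_proj p) ->
  A (diffq F c (deck g p) q)]) in LA.
exact: (continuous_at_nbhs (@deck_continuous _ _ _ g p) LA).
Qed.

Lemma chart_dnbhs_cvg c p : atlas c -> chart_dom c (ucover_proj p) ->
  c (ucover_proj q) - c (ucover_proj p) @[q --> chart_dnbhs c p] --> (0 : Cx R).
Proof.
move=> ac cp; rewrite -(subrr (c (ucover_proj p))).
apply: cvgB; last exact: cvg_cst.
have cc := @chart_cts _ _ c.
rewrite continuous_open_subspace in cc; last exact: chart_dom_open.
move=> A cA; have := continuous_at_nbhs (@ucover_proj_continuous _ _ _ p)
  (continuous_at_nbhs (cc _ (mem_set cp)) cA).
change (nbhs p [set q | A (c (ucover_proj q))] ->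
  nbhs p [set q | c (ucover_proj q) != c (ucover_proj p) ->
    A (c (ucover_proj q))]).
by apply: filterS => q /= Aq _.
Qed.

Lemma diffqE F c p q : c (ucover_proj q) != c (ucover_proj p) ->
  F q = F p + (c (ucover_proj q) - c (ucover_proj p)) *: diffq F c p q.
Proof.
by move=> cqp; rewrite /diffq scalerA divff ?subr_eq0// scale1r addrC subrK.
Qed.

Lemma mx_derivative_cvg F c p L : atlas c -> chart_dom c (ucover_proj p) ->
  mx_derivative F c p L -> F @ chart_dnbhs c p --> F p.
Proof.
move=> ac cp FL; rewrite -[F p]addr0 -(scale0r L).
apply: (@cvg_trans _
  (F p + (c (ucover_proj q) - c (ucover_proj p)) *: diffq F c p q
  @[q --> chart_dnbhs c p])).
  apply: near_eq_cvg; apply: filterS (withinT _ _) => q cqp.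
  by rewrite -diffqE.
apply: cvg_mxD; first exact: cvg_cst.
by apply: cvg_mxZ => //; exact: chart_dnbhs_cvg.
Qed.

Lemma mx_derivativeM F H c p L L' : atlas c -> chart_dom c (ucover_proj p) ->
  mx_derivative F c p L -> mx_derivative H c p L' ->
  mx_derivative (fun q => F q *m H q) c p (L *m H p + F p *m L').
Proof.
move=> ac cp FL HL; rewrite /mx_derivative.
have -> : diffq (fun q => F q *m H q) c p =
    (fun q => diffq F c p q *m H q + F p *m diffq H c p q).
  apply/funext => q; rewrite /diffq -scalemxAl -scalemxAr -scalerDr.
  by rewrite mulmxBl mulmxBr addrA subrK.
apply: cvg_mxD; apply: cvg_mulmx.
- exact: FL.
- exact: mx_derivative_cvg HL.
- exact: cvg_cst.
- exact: HL.
Qed.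

Lemma mx_derivativeB F H c p L L' :
  mx_derivative F c p L -> mx_derivative H c p L' ->
  mx_derivative (fun q => F q - H q) c p (L - L').
Proof.
move=> FL HL; rewrite /mx_derivative.
have -> : diffq (fun q => F q - H q) c p =
    (fun q => diffq F c p q - diffq H c p q).
  by apply/funext => q; rewrite /diffq -scalerBr; congr (_ *: _);
    rewrite !opprD !opprK addrACA.
apply: cvg_mxD; [exact: FL|apply: cvg_mxN; exact: HL].
Qed.

Lemma mx_derivative_cst (M : 'M[Cx R]_n) c p : mx_derivative (fun=> M) c p 0.
Proof.
rewrite /mx_derivative; have -> : diffq (fun=> M) c p = fun=> 0.
  by apply/funext => q; rewrite /diffq subrr scaler0.
exact: cvg_cst.
Qed.

Lemma mx_derivativeV F c p L : (forall q, F q \in unitmx) ->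
  atlas c -> chart_dom c (ucover_proj p) -> mx_derivative F c p L ->
  mx_derivative (fun q => invmx (F q)) c p
    (- (invmx (F p) *m L *m invmx (F p))).
Proof.
move=> Fu ac cp FL; rewrite /mx_derivative.
have -> : diffq (fun q => invmx (F q)) c p =
    (fun q => - (invmx (F q) *m diffq F c p q *m invmx (F p))).
  apply/funext => q; rewrite /diffq -scalemxAr -scalemxAl -scalerN.
  rewrite mulmxBr mulmxBl mulVmx// mul1mx -mulmxA mulmxV// mulmx1.
  by rewrite opprB.
apply: cvg_mxN; apply: cvg_mulmx; last exact: cvg_cst.
apply: cvg_mulmx; last exact: FL.
by apply: cvg_invmx; [|exact: Fu|exact: mx_derivative_cvg FL].
Qed.

Lemma mx_derivative0_constant F :
  (forall c p, atlas c -> chart_dom c (ucover_proj p) ->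
    mx_derivative F c p 0) ->
  forall p q, F p = F q.
Proof.
move=> F0 p q; apply/matrixP => i j.
apply: (zero_derivative_constant (f := fun r => F r i j)) => c r ac cr.
have /cvg_mxP/(_ i j) := F0 c r ac cr; rewrite mxE.
by under eq_cvg do rewrite !mxE.
Qed.

End matrix_derivatives.

Section deformation.
Variables (R : realType) (S : riemannSurface R) (x0 : S) (n : nat).
Variables (A B : mform S n) (W C : ucover R x0 -> 'M[Cx R]_n).
Hypothesis W_fundamental : fundamental_matrix A W.
Hypothesis C_antiderivative : antiderivative B W C.
Let o : ucover R x0 := existT _ x0 (hcst x0).

Let W_unit p : W p \in unitmx := W_fundamental.1 p.

Lemma monodromy_constant (g : pi1 R x0) p q :
  invmx (W p) *m W (deck g p) = invmx (W q) *m W (deck g q).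
Proof.
move: p q; apply: mx_derivative0_constant => c p ac cp.
have WA := has_derivative_mx (W_fundamental.2 c p ac cp).
have WgA := mx_derivative_deck
  (has_derivative_mx (W_fundamental.2 c (deck g p) ac cp)).
apply: (mx_derivative_eq
  (mx_derivativeM ac cp (mx_derivativeV W_unit ac cp WA) WgA)).
rewrite mulNmx !mulmxA -(mulmxA _ (W p)) mulmxV// mulmx1.
by rewrite addNr.
Qed.

Lemma monodromy_exists :
  exists M : GLrep (pi1 R x0) (Cx R) n, monodromy_rep W M.
Proof.
pose M g := invmx (W o) *m W (deck g o).
have WM g p : W (deck g p) = W p *m M g.
  by rewrite /M (monodromy_constant g o p) mulmxA mulmxV// mul1mx.
have Mu g : M g \in unitmx by rewrite unitmx_mul unitmx_inv !W_unit.
have MM g h : M (g * h)%g = M g *m M h.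
  by rewrite /M deckM WM WM !mulmxA mulVmx// mul1mx.
by exists (GLRep Mu MM) => g p; exact: WM.
Qed.

Variable M : GLrep (pi1 R x0) (Cx R) n.
Hypothesis WM : monodromy_rep W M.

Lemma jump_constant (g : pi1 R x0) p q : jump M C g p = jump M C g q.
Proof.
move: p q; apply: mx_derivative0_constant => c p ac cp.
have CB := has_derivative_mx (C_antiderivative ac cp).
have CgB := mx_derivative_deck
  (has_derivative_mx (C_antiderivative (p := deck g p) ac cp)).
have Mu := rep_unit M g.
apply: (mx_derivative_eq (mx_derivativeB
  (mx_derivativeM ac cp (mx_derivativeM ac cp
  (mx_derivative_cst (M g) _ _) CgB) (mx_derivative_cst (invmx (M g)) _ _)) CB)).
rewrite !mul0mx add0r mulmx0 addr0 /= WM invmx_mul//.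
rewrite !mulmxA mulmxV// mul1mx -2!mulmxA.
by rewrite mulmxV// mulmx1 subrr.
Qed.

Lemma jump_cocycle p : cocycle M (jump M C ^~ p).
Proof.
move=> g h; rewrite (jump_constant h p (deck g p)) /jump deckM.
rewrite ad_is_additive /ad rep_mul invmx_mul ?rep_unit// !mulmxA.
by rewrite opprB [X in X + _]addrA subrK addrA subrK subrr.
Qed.

End deformation.

Theorem theorem2p9 (R : realType) (S : riemannSurface R)
    (S_connected : connected [set: S]) (x0 : S) (n : nat)
    (A B : mform S n) (nabla : Cx R -> connection S n)
    (nabla_def : is_deformation A B nabla)
    (P : set (chart R S)) (P_punctures : forall a, P a -> is_puncture a)
    (B_meromorphic : forall a, P a -> meromorphic_at B a)
    (W C : ucover R x0 -> 'M[Cx R]_n)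
    (W_fundamental : fundamental_matrix (nabla 0) W)
    (C_antiderivative : antiderivative B W C) :
  (exists M : GLrep (pi1 R x0) (Cx R) n, monodromy_rep W M) /\
  forall M : GLrep (pi1 R x0) (Cx R) n, monodromy_rep W M ->
    exists (delta : Z1 M) (h : H1 M),
      [/\ forall g p, delta g = jump M C g p,
          forall a, P a ->
            forall p (k : cpath R (ucover_proj p) (ucover_proj p)),
              is_turn a k -> delta (loop_around k) = puncture_jump M C k
        & h = H1_class delta].
Proof.
split=> [|M WM]; first exact: monodromy_exists W_fundamental.
have jump_cst := jump_constant W_fundamental C_antiderivative WM.
pose o : ucover R x0 := existT _ x0 (hcst x0).
have dP : jump M C ^~ o \in cocycles M.
  exact/asboolP/(jump_cocycle W_fundamental C_antiderivative WM).
exists (MkZ1 dP), (H1_class (MkZ1 dP)); split=> // [g p|a _ p k _] /=.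
  exact: jump_cst.
rewrite (jump_cst _ o p) /jump /puncture_jump; congr (ad M _ (C _) - _).
by rewrite /deck /turn /ucover_move /loop_around -hcatA hcatVl hcat1r.
Qed.
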